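(* For every $n\in\mathbb N$, every normed space $\mathbf X=(\mathbb R^n,\|\cdot\|_{\mathbf X})$ satisfies $$\forall\delta\in(0,1),\qquad\frac{1}{1-\sqrt[n]{\delta}}\le\frac12\mathsf{PAD}_\delta(\mathbf X)\le\frac{1+\sqrt[n]{\delta}}{1-\sqrt[n]{\delta}}.$$ Therefore, there are universal constants $c,C>0$ such that for every finite dimensional normed space $\mathbf X$ and every $\delta\in(0,1)$, $$c\max\Big\{1,\frac{\dim(\mathbf X)}{\log(1/\delta)}\Big\}\le\mathsf{PAD}_\delta(\mathbf X)\le C\max\Big\{1,\frac{\dim(\mathbf X)}{\log(1/\delta)}\Big\}.$$
   Context: A random partition $\mathscr P$ of a metric space $(\mathcal M,d_{\mathcal M})$ consists of a probability space $(\Omega,\mathbf{Prob})$ and set-valued mappings $\Gamma^k:\Omega\to2^{\mathcal M}$, $k\in\mathbb N$, such that $\mathscr P^\omega=\{\Gamma^k(\omega)\}_{k=1}^\infty$ is a partition of $\mathcal M$ for every $\omega\in\Omega$ (empty clusters are allowed) and each $\Gamma^k$ is strongly measurable, i.e., $\{\omega:\ E\cap\Gamma^k(\omega)\neq\emptyset\}$ is $\mathbf{Prob}$-measurable for every closed $E\subseteq\mathcal M$. $\mathscr P(x)$ denotes the cluster containing $x$. $\mathscr P$ is $\Delta$-bounded if every cluster of $\mathscr P^\omega$ has $d_{\mathcal M}$-diameter at most $\Delta$, for every $\omega$. For $\delta,\mathfrak p,\Delta>0$, a $\Delta$-bounded random partition $\mathscr P$ is $(\mathfrak p,\delta)$-padded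 if $$\forall x\in\mathcal M,\qquad\mathbf{Prob}\big[B_{\mathcal M}(x,\Delta/\mathfrak p)\subseteq\mathscr P(x)\big]\ge\delta,$$ where $B_{\mathcal M}(x,r)=\{y:\ d_{\mathcal M}(x,y)\le r\}$ is the closed ball. $\mathsf{PAD}_\delta(\mathcal M)$ is the infimum over those $\mathfrak p>0$ such that for every $\Delta>0$ there exists a $(\mathfrak p,\delta)$-padded $\Delta$-bounded random partition of $\mathcal M$ ($\infty$ if there is no such $\mathfrak p$). For a normed space it refers to the metric induced by the norm. *)

(* Defs.v *)
From HB Require Import structures.
From mathcomp Require Import all_boot all_order all_algebra.
From mathcomp Require Import all_classical all_reals all_analysis.
Set Implicit Arguments.
Unset Strict Implicit.
Unset Printing Implicit Defensive.
Import Order.TTheory GRing.Theory Num.Theory.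
Import numFieldNormedType.Exports.
Local Open Scope classical_set_scope.
Local Open Scope ring_scope.

                                                        
Record is_norm (R : realType) (V : lmodType R) (N : V -> R) : Prop := IsNorm {
  is_norm_triangle : forall x y, N (x + y) <= N x + N y ;
  is_norm_scale : forall (a : R) x, N (a *: x) = `|a| * N x ;
  is_norm_eq0 : forall x, N x = 0 -> x = 0
}.

                                                                               
                                                                         
                                   
Definition normed_space (R : realType) (V : lmodType R) (N : V -> R)
  (hN : is_norm N) : Type := V.

Section normed_space.
Context (R : realType) (V : lmodType R) (N : V -> R) (hN : is_norm N).
Let X := normed_space hN.

HB.instance Definition _ := GRing.Lmodule.copy X V.

HB.instance Definition _ := Lmodule_isNormed.Build R X
  (is_norm_triangle hN) (is_norm_scale hN) (is_norm_eq0 hN).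

Let dist (x y : X) : R := `|x - y|.

Let dist_ge0 x y : 0 <= dist x y. Proof. exact: normr_ge0. Qed.

Let dist_positivity x y : dist x y = 0 -> x = y.
Proof. by move=> /normr0_eq0/subr0_eq. Qed.

Let ballEdist x d : ball x d = [set y | dist x y < d].
Proof. by rewrite -ball_normE. Qed.

HB.instance Definition _ := @PseudoMetric_isMetric.Build R X
  dist dist_ge0 dist_positivity ballEdist.

Lemma mdist_normed_space (x y : X) : mdist x y = N ((x : V) - (y : V)).
Proof. by []. Qed.

End normed_space.

                                                                             
Record random_partition (R : realType) (M : metricType R) := RandomPartition {
  rp_display : measure_display ;
  rp_space : measurableType rp_display ;
  rp_prob : probability rp_space R ;
  rp_cluster : nat -> rp_space -> set M ;
  rp_cover : forall w, cover setT (rp_cluster^~ w) = setT ;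
  rp_disjoint : forall w, trivIset setT (rp_cluster^~ w) ;
  rp_strongly_measurable : forall k (E : set M), closed E ->
    measurable [set w | E `&` rp_cluster k w !=set0]
}.

Arguments rp_cluster {R M} _ _ _.

Section padding.
Context (R : realType) (M : metricType R).

Definition cluster_of (P : random_partition M) (w : rp_space P) (x : M) :
  set M := pblock setT ((rp_cluster P)^~ w) x.

                                  
Definition diameter (A : set M) : \bar R :=
  ereal_sup [set (mdist z.1 z.2)%:E | z in A `*` A].

Definition mclosed_ball (x : M) (r : R) : set M := [set y | mdist x y <= r].

Definition bounded_partition (Delta : R) (P : random_partition M) : Prop :=
  forall w k, (diameter (rp_cluster P k w) <= Delta%:E)%E.

                                                                             
                                                                              
                                      
Definition padded_partition (Delta p delta : R) (P : random_partition M) :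
  Prop :=
  forall x : M, (delta%:E <=
    rp_prob P [set w | mclosed_ball x (Delta / p) `<=` cluster_of w x])%E.

Definition PAD (delta : R) : \bar R :=
  ereal_inf [set p%:E | p in [set p : R | 0 < p /\
    forall Delta : R, 0 < Delta -> exists P : random_partition M,
      bounded_partition Delta P /\ padded_partition Delta p delta P]].

End padding.

Arguments cluster_of {R M} P w x.
Arguments PAD {R} M delta.

(* Main.v *)
Require Import Defs.
From HB Require Import structures.
From mathcomp Require Import all_boot all_order all_algebra.
From mathcomp Require Import perm fingroup.
From mathcomp Require Import all_classical all_reals all_analysis.
From mathcomp Require Import measurable_realfun finmap zify ring lra.
Import Order.TTheory GRing.Theory Num.Theory.
Import numFieldNormedType.Exports.
Local Open Scope classical_set_scope.
Local Open Scope ring_scope.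

(** Write [t] for the [n]-th root of [delta].  Both bounds are volume
comparisons between balls of the norm, and volume enters only through the
number of points of a lattice (the integer span of a basis) in a large ball, so
that every quantity below is a finite cardinality.  Besides the Brunn-Minkowski
inequality ([brunn_minkowski_lattice]), the one fact needed about volume is that
dilating a ball by [c] multiplies the count by [c ^ n] up to a bounded change of
radius ([lattice_ball_ratio]).

Lower bound.  Let a random partition into sets of diameter at most [D] be
padded at radius [r = D / p] with probability at least [t ^ n].  A cluster [G]
contains [A + B(r)], where [A] is the set of its padded points, so by the
Brunn-Minkowski inequality the [n]-th root of the volume of [G] is at least
the sum of those of [A] and [B(r)].  Applied to [G] and [- G], whose sum lies
in the ball of radius [D], the same inequality gives that [G] is no larger than
a ball of radius [D / 2].  Hence padded points fill at most the fraction
[(1 - 2 / p) ^ n] of every cluster ([eroded_cell_card]), therefore of every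
large box ([monochromatic_fraction]), while on average they fill at least the
fraction [t ^ n]; so [t <= 1 - 2 / p] ([padded_fraction],
[padding_parameter_ge]).

Upper bound.  Put the lattice points in a random order and send each point of
the space to the first lattice point within distance [D / 2] of it.  The
clusters have diameter at most [D], and the ball [B(x, r)] lies in one cluster
as soon as the first lattice point of [B(x, D / 2 + r)] belongs to
[B(x, D / 2 - r)].  This has probability close to
[((D / 2 - r) / (D / 2 + r)) ^ n], which exceeds [t ^ n] when [p] exceeds
[2 (1 + t) / (1 - t)] and the lattice is fine enough
([padding_parameter_exists]).  Points far apart may share their rank, so a
random permutation of finitely many colours suffices and the probability space
is finite.

The estimate with universal constants follows because [1 / (1 - t)] is within
a factor [2] of [max 1 (n / ln (1 / delta))] ([inv_one_minus_root_bounds]). *)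

(** * Finite sets of integers and their sums *)

Lemma card_fibers (T U : choiceType) (h : T -> U) (A : {fset T}) :
  #|` A| = (\sum_(u <- [fset h x | x in A]%fset) #|` [fset x in A | h x == u]%fset|)%N.
Proof.
rewrite card_fset_sum1 (partition_big_imfset _ h) /=; apply: eq_bigr => u _.
by rewrite card_fset_sum1 big_fset.
Qed.

Lemma fset_argmax (d : Order.disp_t) (O : orderType d) (T : choiceType)
    (f : T -> O) (S : {fset T}) : S != fset0 ->
  exists2 m, m \in S & forall s, s \in S -> (f s <= f m)%O.
Proof.
case/fset0Pn => s0 Ss0.
case: (@Order.TotalTheory.arg_maxP _ _ S [`Ss0]%fset xpredT (f \o val)) => //= i _ hi.
by exists (val i) => [|s Ss]; [exact: valP | exact: (hi [`Ss]%fset)].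
Qed.

Lemma fset_argmin (d : Order.disp_t) (O : orderType d) (T : choiceType)
    (f : T -> O) (S : {fset T}) : S != fset0 ->
  exists2 m, m \in S & forall s, s \in S -> (f m <= f s)%O.
Proof. exact: (@fset_argmax _ O^d T f). Qed.

(** The two translates [S + min S'] and [max S + S' + 1] are disjoint: every
element of the first is at most [max S + min S']. *)
Lemma card_sumset_int (S S' W : {fset int}) (u : int) :
  S != fset0 -> S' != fset0 ->
  (forall s s', s \in S -> s' \in S' -> s + s' + u \in W /\ s + s' + u + 1 \in W) ->
  (#|` S| + #|` S'| <= #|` W|)%N.
Proof.
move=> /(fset_argmax _ _ _ id)[m Sm maxm] /(fset_argmin _ _ _ id)[m' Sm' minm'] SW.
pose A := [fset (s + m' + u)%R | s in S]%fset.
pose B := [fset (m + s + u + 1)%R | s in S']%fset.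
have cA : #|` A| = #|` S| by rewrite card_imfset //= => x y; lia.
have cB : #|` B| = #|` S'| by rewrite card_imfset //= => x y; lia.
rewrite -cA -cB -cardfsUI [X in (_ + X)%N](_ : _ = 0%N) ?addn0; last first.
  apply/eqP; rewrite cardfs_eq0; apply/eqP/fsetP => x; rewrite !inE.
  apply/negP => /andP[/imfsetP[s /= Ss ->] /imfsetP[s' /= Ss' e]].
  by have := maxm _ Ss; have := minm' _ Ss'; lia.
apply: fsubset_leq_card; apply/fsubsetP => x; rewrite inE => /orP[]/imfsetP[s /= Ss ->].
- by have [] := SW _ _ Ss Sm'.
- by have [] := SW _ _ Sm Ss.
Qed.

Lemma sum_ltn_threshold (q c : nat) : (\sum_(j < q) (j < c))%N = minn q c.
Proof.
elim: q => [|q ih]; first by rewrite big_ord0 min0n.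
rewrite big_ord_recr /= ih; case: ltnP; lia.
Qed.

Lemma nth_root_exists (R : realType) (k : nat) (x : R) : (0 < k)%N -> 0 <= x ->
  exists2 y, 0 <= y & y ^+ k = x.
Proof.
move=> k0 x0; exists (x `^ k%:R^-1); first exact: powR_ge0.
by rewrite -powR_mulrn ?powR_ge0// -powRrM mulVf ?powRr1// pnatr_eq0 -lt0n.
Qed.

(** The graph of the convex function [x ^ (k + 1)] lies above its tangent at
[y]. *)
Lemma expr_tangent (R : realFieldType) (k : nat) (x y : R) : 0 <= x -> 0 <= y ->
  y ^+ k.+1 + k.+1%:R * y ^+ k * (x - y) <= x ^+ k.+1.
Proof.
move=> x0 y0; elim: k => [|k ih]; first by rewrite expr0 !expr1; lra.
have /(ler_wpM2r x0) := ih; rewrite -exprSr; apply: le_trans.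
rewrite -subr_ge0 [X in 0 <= X](_ : _ = k.+1%:R * (y ^+ k * (x - y) ^+ 2)).
  by rewrite mulr_ge0// mulr_ge0 ?sqr_ge0 ?exprn_ge0.
by rewrite !exprS -!natr1; ring.
Qed.

(** The function [(c, w) |-> c ^ (k + 1) / w ^ k] is the perspective of a convex
power, hence subadditive.  It is the form of Hoelder's inequality that combines
the slices in the inductive step of Brunn-Minkowski. *)
Lemma radon_ineq (R : realFieldType) (k : nat) (a b u v : R) :
  0 <= a -> 0 <= b -> 0 < u -> 0 < v ->
  (a + b) ^+ k.+1 / (u + v) ^+ k <= a ^+ k.+1 / u ^+ k + b ^+ k.+1 / v ^+ k.
Proof.
move=> a0 b0 u0 v0.
have uv0 : 0 < u + v by rewrite addr_gt0.
have perspective (c w : R) : 0 < w -> c ^+ k.+1 / w ^+ k = (c / w) ^+ k.+1 * w.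
  move=> w0; rewrite expr_div_n [w ^+ k.+1]exprSr; field.
  by rewrite expf_neq0 gt_eqF.
rewrite !perspective//; set y := (a + b) / (u + v).
have y0 : 0 <= y by rewrite divr_ge0 ?addr_ge0// ltW.
have tangent (c w : R) : 0 <= c -> 0 < w ->
    y ^+ k.+1 * w + k.+1%:R * y ^+ k * (c - y * w) <= (c / w) ^+ k.+1 * w.
  move=> c0 w0.
  have := ler_wpM2r (ltW w0) (expr_tangent R k (c / w) y (divr_ge0 c0 (ltW w0)) y0).
  have -> : c - y * w = (c / w - y) * w by rewrite mulrBl divfK ?gt_eqF.
  by rewrite mulrA -mulrDl.
have := lerD (tangent a u a0 u0) (tangent b v b0 v0); apply: le_trans.
rewrite le_eqVlt; apply/orP; left; apply/eqP.
have -> : a = y * (u + v) - b by rewrite /y divfK ?gt_eqF// addrK.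
ring.
Qed.

Lemma sum_threshold_le (R : realFieldType) (q : nat) (x M : R) : 0 <= x ->
  (\sum_(j < q) (j.+1%:R * M <= x)%R)%:R * M <= x.
Proof.
move=> x0; elim: q => [|q ih]; first by rewrite big_ord0 mul0r.
rewrite big_ord_recr /=; case: (leP (q.+1%:R * M) x) => [le_x|_]; last by rewrite addn0.
have [M0|M0] := leP 0 M; last first.
  by apply: le_trans x0; rewrite mulr_ge0_le0// ltW.
apply: le_trans le_x; rewrite ler_wpM2r// ler_nat addn1 ltnS.
by rewrite -[leqRHS]card_ord -sum1_card leq_sum// => j _; case: (_ <= _).
Qed.

(** One-dimensional Prekopa-Leindler step.  If the superlevel sets of [f / mX],
[g / mY] and [h / M] satisfy the one-dimensional Brunn-Minkowski inequality at
every level, summing over the levels gives the same inequality for the totals.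
All values of [f / mX] and [g / mY] are multiples of [1 / (mX * mY)], so the
levels [j / (mX * mY)] are enough and the layer-cake integral is a finite
sum. *)
Lemma layer_cake_slices (R : realFieldType) (S S' W : {fset int})
    (f g h : int -> nat) (mX mY : nat) (M : R) :
  (0 < mX)%N -> (0 < mY)%N -> 0 < M ->
  (forall s, s \in S -> (f s <= mX)%N) -> (forall s, s \in S' -> (g s <= mY)%N) ->
  (forall j, (0 < j <= mX * mY)%N ->
    (#|` [fset s in S | (j <= mY * f s)%N]%fset| +
     #|` [fset s in S' | (j <= mX * g s)%N]%fset| <=
     #|` [fset w in W | (j%:R * M <= (mX * mY * h w)%:R)%R]%fset|)%N) ->
  M * ((\sum_(s <- S) f s)%:R / mX%:R + (\sum_(s <- S') g s)%:R / mY%:R)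
    <= (\sum_(w <- W) h w)%:R.
Proof.
move=> mX0 mY0 M0 fm gm step; set q := (mX * mY)%N in step *.
have countE (A : {fset int}) (P : nat -> int -> bool) :
    (\sum_(j < q) #|` [fset s in A | P j s]%fset| =
     \sum_(s <- A) \sum_(j < q) P j s)%N.
  rewrite exchange_big; apply: eq_bigr => j _.
  rewrite card_fset_sum1 big_fset /= big_mkcond /=.
  by apply: eq_bigr => s _; case: P.
have levels (A : {fset int}) (m m' : nat) (e : int -> nat) :
    q = (m * m')%N -> (forall s, s \in A -> (e s <= m')%N) ->
    (\sum_(j < q) #|` [fset s in A | (j < m * e s)%N]%fset| =
     m * \sum_(s <- A) e s)%N.
  move=> qE em; rewrite (countE A (fun j s => j < m * e s)%N) big_distrr /=.
  rewrite big_seq_cond [RHS]big_seq_cond; apply: eq_bigr => s /andP[sA _].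
  by rewrite sum_ltn_threshold; apply/minn_idPr; rewrite qE leq_mul2l em ?orbT.
have := @leq_sum _ (index_enum 'I_q) xpredT _ _ (fun j _ => step j.+1 (ltn_ord j)).
rewrite big_split /= (levels S mY mX f (mulnC _ _))// (levels S' mX mY g)//.
rewrite (countE W (fun j w => j.+1%:R * M <= (q * h w)%:R)) => leW.
have q0 : (0 : R) < q%:R by rewrite ltr0n muln_gt0 mX0.
have {}leW : (mY%:R * (\sum_(s <- S) f s)%:R + mX%:R * (\sum_(s <- S') g s)%:R) * M
    <= q%:R * (\sum_(w <- W) h w)%:R.
  rewrite -!natrM -natrD; apply: (@le_trans _ _ ((\sum_(w <- W)
    \sum_(j < q) (j.+1%:R * M <= (q * h w)%:R)%R)%:R * M)).
    by apply: ler_wpM2r; [exact: ltW | rewrite ler_nat].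
  rewrite big_distrr /= !natr_sum mulr_suml; apply: ler_sum => w _.
  exact: sum_threshold_le.
rewrite -(ler_pM2l q0); apply: le_trans leW.
rewrite le_eqVlt; apply/orP; left; apply/eqP; rewrite /q natrM; field.
by rewrite !pnatr_eq0 -!lt0n mX0 mY0.
Qed.

(** * The Brunn-Minkowski inequality in the integer lattice *)

(** Induction on the number [k] of coordinates that may vary.  The sets are cut
into slices along the last free coordinate.  At a common relative level [t ^ k]
of the largest slices, slices of [X] and [Y] add up to slices of [Z] by the
induction hypothesis, and the positions of such slices obey the
one-dimensional inequality.  The layer-cake lemma then bounds the cardinal of
[Z], and [radon_ineq] finishes.  The offset [e] absorbs the unit translation
along the sliced coordinate. *)
Lemma brunn_minkowski_free_coords (R : realType) (n k : nat) : (k <= n)%N ->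
  forall (X Y Z : {fset 'rV[int]_n}) (e : 'rV[int]_n) (a b : R),
  X != fset0 -> Y != fset0 -> 0 <= a -> 0 <= b ->
  {in X &, forall (x x' : 'rV[int]_n) (i : 'I_n), (k <= i)%N -> x 0 i = x' 0 i} ->
  {in Y &, forall (y y' : 'rV[int]_n) (i : 'I_n), (k <= i)%N -> y 0 i = y' 0 i} ->
  (forall x y (d : 'I_n -> bool), x \in X -> y \in Y ->
    (forall i : 'I_n, (k <= i)%N -> d i = false) ->
    x + y + e + \row_i (d i)%:Z \in Z) ->
  a ^+ k <= #|` X|%:R -> b ^+ k <= #|` Y|%:R -> (a + b) ^+ k <= #|` Z|%:R.
Proof.
elim: k => [_|k ih kn] X Y Z e a b X0 Y0 a0 b0 Xk Yk XYZ aX bY.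
  rewrite expr0 ler1n cardfs_gt0; apply/fset0Pn.
  case/fset0Pn: X0 => x Xx; case/fset0Pn: Y0 => y Yy.
  by exists (x + y + e + \row_i (false : nat)%:Z); apply: XYZ.
pose i0 : 'I_n := Ordinal kn.
pose sl (A : {fset 'rV[int]_n}) (s : int) := [fset x in A | x 0 i0 == s]%fset.
pose im (A : {fset 'rV[int]_n}) := [fset x 0 i0 | x : 'rV[int]_n in A]%fset.
have im0 A : A != fset0 -> im A != fset0.
  by case/fset0Pn => x Ax; apply/fset0Pn; exists (x 0 i0); apply: in_imfset.
have sl0 A s : s \in im A -> sl A s != fset0.
  by case/imfsetP => x /= Ax ->; apply/fset0Pn; exists x; rewrite !inE Ax eqxx.
have [sX SX /= maxX] := fset_argmax _ nat _ (fun s => #|` sl X s|) _ (im0 _ X0).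
have [sY SY /= maxY] := fset_argmax _ nat _ (fun s => #|` sl Y s|) _ (im0 _ Y0).
set mX := #|` sl X sX| in maxX; set mY := #|` sl Y sY| in maxY.
have mX0 : (0 < mX)%N by rewrite cardfs_gt0 sl0.
have mY0 : (0 < mY)%N by rewrite cardfs_gt0 sl0.
have slk (A : {fset 'rV[int]_n}) s :
    {in A &, forall (x x' : 'rV[int]_n) (i : 'I_n), (k.+1 <= i)%N -> x 0 i = x' 0 i} ->
    {in sl A s &, forall (x x' : 'rV[int]_n) (i : 'I_n), (k <= i)%N -> x 0 i = x' 0 i}.
  move=> Ak x x'; rewrite !inE => /andP[Ax /eqP xs] /andP[Ax' /eqP xs'] i.
  rewrite leq_eqVlt => /orP[/eqP ki|]; last exact: Ak.
  by have -> : i = i0 by [exact: val_inj]; rewrite xs xs'.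
have sl1 (A : {fset 'rV[int]_n}) s : k = 0%N -> s \in im A ->
    {in A &, forall (x x' : 'rV[int]_n) (i : 'I_n), (k.+1 <= i)%N -> x 0 i = x' 0 i} ->
    #|` sl A s| = 1%N.
  move=> kz sA Ak; case/fset0Pn: (sl0 _ _ sA) => x xs.
  apply/eqP/cardfs1P; exists x; apply/fsetP => y; rewrite in_fset1.
  apply/idP/eqP => [ys|-> //]; apply/rowP => i.
  by apply: (slk A s Ak) => //; rewrite kz.
(* For [k = 0] slices are points and [1] serves as a root of order 0. *)
have root_of (A : {fset 'rV[int]_n}) s : s \in im A ->
    {in A &, forall (x x' : 'rV[int]_n) (i : 'I_n), (k.+1 <= i)%N -> x 0 i = x' 0 i} ->
    exists2 u : R, 0 < u & u ^+ k = #|` sl A s|%:R.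
  move=> sA Ak; have [kz|k0] := posnP k.
    by exists 1; rewrite // expr1n (sl1 A s).
  have [u u0 uk] := nth_root_exists R k #|` sl A s|%:R k0 (ler0n _ _).
  exists u => //; rewrite lt_neqAle u0 andbT eq_sym; apply: contraTneq (sl0 _ _ sA) => uz.
  by rewrite negbK -cardfs_eq0 -(eqr_nat R) -uk uz expr0n gtn_eqF.
have [u u0 uX] := root_of X sX SX Xk.
have [v v0 vY] := root_of Y sY SY Yk.
rewrite -/mX in uX; rewrite -/mY in vY.
have M0 : 0 < (u + v) ^+ k by rewrite exprn_gt0// addr_gt0.
have slices : (u + v) ^+ k * (#|` X|%:R / mX%:R + #|` Y|%:R / mY%:R) <= #|` Z|%:R.
  rewrite (card_fibers _ _ (fun x : 'rV[int]_n => x 0 i0) X).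
  rewrite (card_fibers _ _ (fun x : 'rV[int]_n => x 0 i0) Y).
  rewrite (card_fibers _ _ (fun x : 'rV[int]_n => x 0 i0) Z).
  apply: (layer_cake_slices R (im X) (im Y) (im Z)) => // j /andP[j0 jq].
  pose Xj := [fset s in im X | (j <= mY * #|` sl X s|)%N]%fset.
  pose Yj := [fset s in im Y | (j <= mX * #|` sl Y s|)%N]%fset.
  apply: (card_sumset_int Xj Yj _ (e 0 i0)).
  - by apply/fset0Pn; exists sX; rewrite !inE SX mulnC.
  - by apply/fset0Pn; exists sY; rewrite !inE SY.
  move=> s s'; rewrite !inE => /andP[/= sS js] /andP[/= sS' js'].
  have q0 : (0 : R) < (mX * mY)%:R by rewrite ltr0n muln_gt0 mX0.
  (* The level is given through a root, so that the hypothesis applies to the dilated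
     radii [t * u] and [t * v].  For [k = 0] the level [1] is available. *)
  have [t t0 [jt tX tY]] : exists2 t : R, 0 <= t & [/\ j%:R / (mX * mY)%:R <= t ^+ k,
      t ^+ k * mX%:R <= #|` sl X s|%:R & t ^+ k * mY%:R <= #|` sl Y s'|%:R].
    have [kz|k0] := posnP k.
      exists 1; rewrite // expr1n !mul1r ler_pdivrMr// mul1r !ler_nat.
      by rewrite jq (sl1 _ s)// (sl1 _ s')// /mX sl1// /mY sl1.
    have [t t0 tk] := nth_root_exists R k (j%:R / (mX * mY)%:R) k0
      (divr_ge0 (ler0n _ _) (ltW q0)).
    exists t; rewrite // tk lexx natrM; split=> //.
      rewrite -(@ler_pM2l _ mY%:R) ?ltr0n//; apply: (@le_trans _ _ j%:R).
        rewrite le_eqVlt; apply/orP; left; apply/eqP; field.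
        by rewrite !pnatr_eq0 -!lt0n mX0 mY0.
      by rewrite -natrM ler_nat.
    rewrite -(@ler_pM2l _ mX%:R) ?ltr0n//; apply: (@le_trans _ _ j%:R).
      rewrite le_eqVlt; apply/orP; left; apply/eqP; field.
      by rewrite !pnatr_eq0 -!lt0n mX0 mY0.
    by rewrite -natrM ler_nat.
  have slice_bound (c : bool) : s + s' + e 0 i0 + c%:Z \in im Z /\
      j%:R * (u + v) ^+ k <= (mX * mY * #|` sl Z (s + s' + e 0 i0 + c%:Z)|)%:R.
    have XYZc x y (d : 'I_n -> bool) : x \in sl X s -> y \in sl Y s' ->
        (forall i : 'I_n, (k <= i)%N -> d i = false) ->
        x + y + (e + \row_i ((i == i0) && c : nat)%:Z) + \row_i (d i)%:Z
          \in sl Z (s + s' + e 0 i0 + c%:Z).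
      rewrite !inE /= => /andP[Xx /eqP xs] /andP[Yy /eqP ys] dk.
      rewrite !mxE eqxx xs ys dk// addr0 !addrA eqxx andbT.
      pose d' i := d i || (i == i0) && c.
      rewrite (_ : _ + _ + _ = x + y + e + \row_i (d' i)%:Z); last first.
        rewrite -[LHS]addrA; congr (_ + _); apply/rowP => i; rewrite !mxE /d'.
        case: eqVneq => [->|_] /=; last by rewrite orbF add0r.
        by rewrite dk//= addr0.
      apply: XYZ => // i ki; rewrite /d' dk 1?ltnW//=.
      by case: eqVneq ki => // ->; rewrite ltnn.
    split.
      case/fset0Pn: (sl0 _ _ sS) => x Xx; case/fset0Pn: (sl0 _ _ sS') => y Yy.
      have := XYZc x y (fun _ => false) Xx Yy (fun _ _ => erefl).
      by rewrite inE => /andP[/= Zz /eqP <-]; apply: in_imfset.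
    have := ih (ltnW kn) _ _ _ _ (t * u) (t * v) (sl0 _ _ sS) (sl0 _ _ sS')
      (mulr_ge0 t0 (ltW u0)) (mulr_ge0 t0 (ltW v0)) (slk _ s Xk) (slk _ s' Yk) XYZc.
    rewrite -mulrDr !exprMn uX vY => /(_ tX tY) le_t.
    rewrite natrM -ler_pdivrMl// mulrA; apply: le_trans le_t.
    by rewrite ler_wpM2r ?(ltW M0)// mulrC.
  have [Z0 h0] := slice_bound false; have [Z1 h1] := slice_bound true.
  by rewrite addr0 in Z0 h0; split; apply/andP; split.
apply: le_trans slices; rewrite -ler_pdivrMl//.
rewrite mulrC; apply: le_trans (radon_ineq R k a b u v a0 b0 u0 v0) _.
by rewrite uX vY lerD// ler_wpM2r// invr_ge0.
Qed.

(** Adding the vertices of the unit cube makes up for the missing volume of a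
lattice point.  The numbers [a] and [b] stand for the roots of order [n] of the
cardinals. *)
Lemma brunn_minkowski_lattice (R : realType) (n : nat)
    (X Y Z : {fset 'rV[int]_n}) (a b : R) :
  X != fset0 -> Y != fset0 -> 0 <= a -> 0 <= b ->
  (forall x y (d : 'I_n -> bool), x \in X -> y \in Y ->
    x + y + \row_i (d i)%:Z \in Z) ->
  a ^+ n <= #|` X|%:R -> b ^+ n <= #|` Y|%:R -> (a + b) ^+ n <= #|` Z|%:R.
Proof.
move=> X0 Y0 a0 b0 XYZ.
apply: (brunn_minkowski_free_coords _ _ _ (leqnn n) X Y Z 0) => //.
- by move=> x x' _ _ i; rewrite leqNgt ltn_ord.
- by move=> x x' _ _ i; rewrite leqNgt ltn_ord.
- by move=> x y d Xx Yy _; rewrite addr0 XYZ.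
Qed.

(** * Counting lattice points in balls *)

Lemma card_fibers_onto (T U : choiceType) (h : T -> U) (A : {fset T}) (B : {fset U}) :
  (forall x, x \in A -> h x \in B) ->
  #|` A| = (\sum_(u <- B) #|` [fset x in A | h x == u]%fset|)%N.
Proof.
move=> hAB; rewrite (card_fibers _ _ h); apply: big_fset_incl.
  by apply/fsubsetP => u /imfsetP[x /= Ax ->]; exact: hAB.
move=> u _ uA; apply/eqP; rewrite cardfs_eq0; apply/eqP/fsetP => x.
rewrite !inE /=; apply: contraNF uA => /andP[Ax /eqP <-]; exact: in_imfset.
Qed.

Section integer_boxes.
Context {n : nat}.
Implicit Types z : 'rV[int]_n.

Definition box (o : int) (L : nat) : {fset 'rV[int]_n} :=
  let pt (w : 'rV['I_L]_n) := \row_i (o + (w 0 i : nat)%:Z) in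
  [fset pt w | w : 'rV['I_L]_n]%fset.

Lemma in_box o L z : (z \in box o L) = [forall i, o <= z 0 i < o + L%:Z].
Proof.
apply/imfsetP/forallP => [[w _ ->] i|zb]; first by rewrite mxE lerDl ltrD2l ltz_nat ltn_ord.
have zL i : (`|z 0%R i - o| < L)%N by have := zb i; lia.
exists (\row_i Ordinal (zL i)) => //; apply/rowP => i; rewrite !mxE /=.
by have := zb i; lia.
Qed.

Lemma card_box o L : #|` box o L| = (L ^ n)%N.
Proof.
rewrite card_imfset /=; first by rewrite -cardE card_mx card_ord mul1n.
move=> w w' /rowP ww'; apply/rowP => i; apply: val_inj => /=.
by have := ww' i; rewrite !mxE; lia.
Qed.

Definition cell_of (q : nat) z : 'rV[int]_n := \row_i (z 0%R i %/ q%:Z)%Z.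

Lemma cell_ofP (q : nat) z u : (0 < q)%N ->
  (cell_of q z == u) = (z - u *+ q \in box 0 q).
Proof.
move=> q0; rewrite in_box; apply/eqP/forallP => [<- i|zu].
  rewrite !mxE mulmxnE mxE -mulr_natr natz add0r.
  have q0' : 0 < q%:Z by [].
  rewrite {1 3}(divz_eq (z 0 i) q) addrC addKr.
  by rewrite modz_ge0 ?ltz_pmod// gt_eqF.
apply/rowP => i; rewrite mxE; have := zu i.
rewrite !mxE mulmxnE -mulr_natr natz add0r => zi.
rewrite (_ : z 0 i = u 0 i * q%:Z + (z 0 i - u 0 i * q%:Z)); last by ring.
by rewrite divzMDl ?divz_small ?addr0//; lia.
Qed.

Definition translate (s : 'rV[int]_n) (A : {fset 'rV[int]_n}) : {fset 'rV[int]_n} :=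
  [fset (z + s)%R | z in A]%fset.

Lemma card_translate s A : #|` translate s A| = #|` A|.
Proof. by rewrite card_imfset //=; exact: addIr. Qed.

Lemma card_cell (q : nat) u (A : {fset 'rV[int]_n}) : (0 < q)%N ->
  (forall z, cell_of q z = u -> z \in A) ->
  #|` [fset z in A | cell_of q z == u]%fset| = (q ^ n)%N.
Proof.
move=> q0 uA.
suff E : [fset z in A | cell_of q z == u]%fset = translate (u *+ q) (box 0 q).
  by rewrite E card_translate card_box.
apply/fsetP => z; rewrite !inE /=.
apply/andP/imfsetP => [[_]|[w /= wb ->]].
  by rewrite cell_ofP// => zb; exists (z - u *+ q); rewrite //= subrK.
have uw : cell_of q (w + u *+ q) == u by rewrite cell_ofP// addrK.
by split=> //; apply: uA; exact/eqP.
Qed.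

Lemma card_cell_le (q : nat) u (A : {fset 'rV[int]_n}) : (0 < q)%N ->
  (#|` [fset z in A | cell_of q z == u]%fset| <= q ^ n)%N.
Proof.
move=> q0; rewrite -(card_box 0 q) -(card_translate (u *+ q) (box 0 q)).
apply: fsubset_leq_card; apply/fsubsetP => z; rewrite !inE => /andP[/= _].
by rewrite cell_ofP// => zb; apply/imfsetP; exists (z - u *+ q); rewrite //= subrK.
Qed.

End integer_boxes.

Section norm_facts.
Context (R : realType) (V : lmodType R) (N : V -> R) (hN : is_norm N).

Lemma is_norm0 : N 0 = 0.
Proof. by rewrite -(scale0r 0) (is_norm_scale hN) normr0 mul0r. Qed.

Lemma is_normN x : N (- x) = N x.
Proof. by rewrite -scaleN1r (is_norm_scale hN) normrN1 mul1r. Qed.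

Lemma is_norm_ge0 x : 0 <= N x.
Proof.
have := is_norm_triangle hN x (- x).
by rewrite subrr is_norm0 is_normN -mulr2n pmulrn_lge0.
Qed.

Lemma is_normB x y : N (x - y) = N (y - x).
Proof. by rewrite -opprB is_normN. Qed.

Lemma is_norm_dist x y z : N (x - z) <= N (x - y) + N (y - z).
Proof. by rewrite -(subrKA y); exact: (is_norm_triangle hN). Qed.

End norm_facts.

(** The image of the integer lattice in a normed space.  The [mesh] bounds both
the distance to the lattice and the size of its unit cell; the [spread]
compares coordinates with the norm, which makes balls finite. *)
Record lattice_frame (R : realType) (V : lmodType R) (N : V -> R) (n : nat) :=
  LatticeFrame {
  lattice_point :> {additive 'rV[int]_n -> V} ;
  mesh : R ;
  mesh_ge0 : 0 <= mesh ;
  lattice_cover : forall x, exists z, N (x - lattice_point z) <= mesh ;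
  lattice_cell : forall (m : nat) (z : 'rV[int]_n), (forall i, 0 <= z 0 i <= m%:Z) ->
    N (lattice_point z) <= m%:R * mesh ;
  spread : R ;
  spread_ge0 : 0 <= spread ;
  lattice_coord : forall (z : 'rV[int]_n) i, `|z 0 i|%:~R <= spread * N (lattice_point z)
}.

Arguments lattice_point {R V N n}.
Arguments mesh {R V N n}.
Arguments mesh_ge0 {R V N n}.
Arguments lattice_cover {R V N n}.
Arguments lattice_cell {R V N n}.
Arguments spread {R V N n}.
Arguments spread_ge0 {R V N n}.
Arguments lattice_coord {R V N n}.

Section lattice_counting.
Context (R : realType) (V : lmodType R) (N : V -> R) (hN : is_norm N) (n : nat).
Context (F : lattice_frame R V N n).
Implicit Types (x y : V) (rho : R).

Local Notation K := (mesh F).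

Definition lattice_ball x rho : {fset 'rV[int]_n} :=
  fset_set [set z | N (F z - x) <= rho].

Lemma lattice_coord_nat rho : exists m : nat, forall z, N (F z) <= rho ->
  forall i, `|z 0 i| <= m%:Z.
Proof.
exists (Num.trunc (spread F * rho)).+1 => z zr i.
rewrite ltW// -(ltr_int R); apply: le_lt_trans (truncnS_gt (spread F * rho)).
by apply: le_trans (lattice_coord F z i) _; rewrite ler_wpM2l ?spread_ge0.
Qed.

Lemma in_lattice_ball x rho z : (z \in lattice_ball x rho) = (N (F z - x) <= rho).
Proof.
rewrite in_fset_set; first by apply/idP/idP => [/set_mem|zr] //; apply: mem_set.
have [m zm] := lattice_coord_nat (rho + N x).
apply: (@finite_subfset _ (box (- m%:Z) (m + m).+1)) => {}z /= zr.
have Fz : N (F z) <= rho + N x.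
  by rewrite -{1}(subrK x (F z)); apply: le_trans (is_norm_triangle hN _ _) _; rewrite lerD2r.
rewrite in_box; apply/forallP => i; have := zm _ Fz i; rewrite ler_norml => /andP[-> /= zu].
by apply: le_lt_trans zu _; lia.
Qed.

Lemma lattice_ball_shift x y rho :
  (#|` lattice_ball x rho| <= #|` lattice_ball y (rho + K)|)%N.
Proof.
have [s ys] := lattice_cover F (y - x).
rewrite -(card_translate s (lattice_ball x rho)); apply: fsubset_leq_card.
apply/fsubsetP => ? /imfsetP[z /= + ->]; rewrite !in_lattice_ball (raddfD F) => zr.
rewrite (_ : _ - y = (F z - x) + - (y - x - F s)); last first.
  by rewrite !opprB addrACA addKr.
by apply: le_trans (is_norm_triangle hN _ _) _; rewrite is_normN// lerD.
Qed.

(** Each lattice point [u] owns the [p ^ n] points of the cell of side [p] at [p * u]. *)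
Lemma lattice_ball_refine (p : nat) x rho : (0 < p)%N ->
  (p ^ n * #|` lattice_ball x rho| <=
   #|` lattice_ball (p%:R *: x) (p%:R * (rho + K))|)%N.
Proof.
move=> p0; set A := lattice_ball (p%:R *: x) _.
pose A' := [fset z in A | cell_of p z \in lattice_ball x rho]%fset.
apply: (@leq_trans #|` A'|); last first.
  by apply: fsubset_leq_card; apply/fsubsetP => z; rewrite inE => /andP[].
rewrite (card_fibers_onto _ _ (cell_of p) A' (lattice_ball x rho)); last first.
  by move=> z; rewrite !inE => /andP[].
rewrite card_fset_sum1 big_distrr /= big_seq_cond [leqRHS]big_seq_cond.
apply: leq_sum => u /andP[uB _]; rewrite muln1 card_cell// => z zu.
rewrite !inE /= zu uB andbT in_lattice_ball.
move/eqP: zu; rewrite cell_ofP// in_box => /forallP zu.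
rewrite -[z](subrK (u *+ p)) (raddfD F) (raddfMn F) -addrA -[F u *+ p]scaler_nat -scalerBr.
apply: le_trans (is_norm_triangle hN _ _) _; rewrite addrC mulrDr lerD//.
  by rewrite (is_norm_scale hN) ger0_norm// ler_wpM2l// -in_lattice_ball.
by apply: lattice_cell => i; have /andP[-> /ltW] := zu i; rewrite add0r.
Qed.

Lemma lattice_ball_coarsen (q : nat) x rho : (0 < q)%N ->
  (#|` lattice_ball (q%:R *: x) rho| <=
   q ^ n * #|` lattice_ball x (rho / q%:R + K)|)%N.
Proof.
move=> q0; have q0' : (0 : R) < q%:R by rewrite ltr0n.
set A := lattice_ball (q%:R *: x) _; set B := lattice_ball x _.
rewrite (card_fibers_onto _ _ (cell_of q) A B).
  rewrite [#|` B|]card_fset_sum1 big_distrr /=.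
  by apply: leq_sum => u _; rewrite muln1 card_cell_le.
move=> z; rewrite !in_lattice_ball => zr.
have := eqxx (cell_of q z); rewrite cell_ofP// in_box => /forallP zq.
rewrite -(ler_pM2l q0') -{1}(ger0_norm (ltW q0')) -(is_norm_scale hN).
rewrite mulrDr mulrCA divff ?gt_eqF// mulr1 scalerBr scaler_nat -(raddfMn F) /=.
set w := z - _ in zq; rewrite (_ : F _ = F z - F w); last by rewrite -(raddfB F) opprB addrC subrK.
rewrite addrAC; apply: le_trans (is_norm_triangle hN _ _) _; rewrite is_normN// lerD//.
by apply: lattice_cell => i; have /andP[-> /ltW] := zq i; rewrite add0r.
Qed.

(** Balls of radii proportional to [q] and [p] contain numbers of points
proportional to [q ^ n] and [p ^ n], up to a bounded change of the radius: after
scaling, one ball is compared with the same ball for the lattice refined [p]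
times and the other for the lattice refined [q] times. *)
Lemma lattice_ball_ratio (p q : nat) x y rho : (0 < p)%N -> (0 < q)%N ->
  (p ^ n * #|` lattice_ball x rho| <=
   q ^ n * #|` lattice_ball y (p%:R / q%:R * (rho + 2 * K) + K)|)%N.
Proof.
move=> p0 q0; have p0' : p%:R != 0 :> R by rewrite pnatr_eq0 -lt0n.
pose w := p%:R^-1 *: y.
apply: leq_trans (leq_mul (leqnn _) (lattice_ball_shift x (q%:R *: w) rho)) _.
apply: leq_trans (lattice_ball_refine _ _ _ p0) _.
rewrite scalerA mulrC -scalerA.
apply: leq_trans (lattice_ball_coarsen _ _ _ q0) _.
rewrite scalerA divff// scale1r leq_mul2l; apply/orP; right.
rewrite (_ : p%:R * _ / _ = p%:R / q%:R * (rho + 2 * K))// mulrAC -addrA.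
by rewrite [2 * K]mulr_natl.
Qed.

End lattice_counting.

(** * Padded points fill a small fraction of a cluster *)

Section lower.
Context (R : realType) (V : lmodType R) (N : V -> R) (hN : is_norm N) (n : nat).
Context (F : lattice_frame R V N n).
Context (n0 : (0 < n)%N).

Local Notation K := (mesh F).
Local Notation lball := (lattice_ball R V N n F).
Let in_lball := in_lattice_ball R V N hN n F.

Lemma lattice_cube (d : 'I_n -> bool) : N (F (\row_i (d i)%:Z)) <= K.
Proof.
by rewrite -[leRHS]mul1r; apply: (lattice_cell F 1) => i; rewrite mxE; case: (d i).
Qed.

(** Two applications of Brunn-Minkowski: [A + B(r)] lies in [G], so the root of
[#|G|] exceeds that of [#|A|] by the root of the number of points of [B(r)];
and [G - G] lies in [B(D)], so the root of [#|G|] is at most half that of the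
number of points of [B(D)].  The rational [P / Q] is a lower approximation of
[r / D], and the hypothesis on it leaves room for the mesh errors. *)
Lemma eroded_cell_card (P Q : nat) (r D : R) (A G : {fset 'rV[int]_n}) :
  (0 < P)%N -> (0 < Q)%N -> K <= r ->
  P%:R / Q%:R * (D + K + 2 * K) + K <= r - K ->
  {in G &, forall z z' : 'rV[int]_n, N (F z - F z') <= D} ->
  (forall z h, z \in A -> N (F h) <= r -> z + h \in G) ->
  #|` A|%:R <= Num.max 0 (1 - 2 * (P%:R / Q%:R)) ^+ n * #|` G|%:R :> R.
Proof.
move=> P0 Q0 Kr ratio Gdiam AG; set c := Num.max _ _.
have c0 : 0 <= c by rewrite le_max lexx.
have [->|A0] := eqVneq A fset0; first by rewrite cardfs0 mulr_ge0 ?exprn_ge0.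
have F0 : F 0 = 0 by exact: raddf0.
have N0 : N 0 = 0 := is_norm0 _ _ _ hN.
have G0 : G != fset0.
  case/fset0Pn: A0 => z Az; apply/fset0Pn; exists (z + 0); apply: AG => //.
  by rewrite F0 N0 (le_trans (mesh_ge0 F)).
pose Y := lball 0 (r - K).
have Y0 : Y != fset0.
  by apply/fset0Pn; exists 0; rewrite in_lball F0 subrr N0 subr_ge0.
have [a a0 aA] := nth_root_exists R n #|` A|%:R n0 (ler0n _ _).
have [y y0 yY] := nth_root_exists R n #|` Y|%:R n0 (ler0n _ _).
have [g g0 gG] := nth_root_exists R n #|` G|%:R n0 (ler0n _ _).
have root_le (s t : R) : 0 <= s -> 0 <= t -> s ^+ n <= t ^+ n -> s <= t.
  by move=> s0 t0; rewrite ler_pXn2r.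
have ay_g : a + y <= g.
  apply: root_le; rewrite ?addr_ge0// gG.
  apply: (brunn_minkowski_lattice R n A Y G); rewrite ?aA ?yY// => x h d Ax.
  rewrite in_lball subr0 -addrA => hr; apply: AG => //; rewrite (raddfD F).
  apply: le_trans (is_norm_triangle hN _ _) _.
  by rewrite -(subrK K r) lerD// lattice_cube.
have gg_y : P%:R * (g + g) <= Q%:R * y.
  apply: root_le; rewrite ?mulr_ge0 ?addr_ge0// !exprMn yY.
  pose B := lball 0 (D + K).
  apply: (@le_trans _ _ (P%:R ^+ n * #|` B|%:R)).
    rewrite ler_wpM2l ?exprn_ge0//.
    pose G' := [fset (- z)%R | z in G]%fset.
    have cG' : #|` G'| = #|` G| by rewrite card_imfset //=; exact: oppr_inj.
    apply: (brunn_minkowski_lattice R n G G' B); rewrite ?cG' ?gG//.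
      by rewrite -cardfs_gt0 cG' cardfs_gt0.
    move=> x x' d Gx /imfsetP[z /= Gz ->]; rewrite in_lball subr0 (raddfD F).
    apply: le_trans (is_norm_triangle hN _ _) _.
    by rewrite (raddfB F) lerD ?lattice_cube ?Gdiam.
  rewrite -!natrX -!natrM ler_nat.
  apply: leq_trans (lattice_ball_ratio R V N hN n F P Q 0 0 (D + K) P0 Q0) _.
  rewrite leq_mul2l; apply/orP; right; apply: fsubset_leq_card.
  by apply/fsubsetP => z; rewrite !in_lball => /le_trans; apply.
rewrite -aA -gG -exprMn; rewrite ler_pXn2r ?nnegrE ?mulr_ge0//.
apply: (@le_trans _ _ ((1 - 2 * (P%:R / Q%:R)) * g)); last first.
  by rewrite ler_wpM2r// le_max lexx orbT.
have Q0' : (0 : R) < Q%:R by rewrite ltr0n.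
have : P%:R / Q%:R * (g + g) <= y.
  by rewrite mulrAC ler_pdivrMr// [y * _]mulrC.
move: ay_g; move: (P%:R / Q%:R) => c' ? ?; lra.
Qed.

(** The classes of [kappa] are the traces of the clusters on the lattice, and [A]
consists of points whose ball of radius [r] is monochromatic.  Summing the
previous bound over the classes costs only the enlargement of the box by the
coordinates of the ball. *)
Lemma monochromatic_fraction (P Q : nat) (r D : R) (T : choiceType)
    (kappa : 'rV[int]_n -> T) (L m : nat) (A : {fset 'rV[int]_n}) :
  (0 < P)%N -> (0 < Q)%N -> K <= r ->
  P%:R / Q%:R * (D + K + 2 * K) + K <= r - K ->
  (forall z z', kappa z = kappa z' -> N (F z - F z') <= D) ->
  (forall h, N (F h) <= r -> forall i, `|h 0 i| <= m%:Z) ->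
  (forall z, z \in A -> z \in box 0 L) ->
  (forall z h, z \in A -> N (F h) <= r -> kappa (z + h) = kappa z) ->
  #|` A|%:R <= Num.max 0 (1 - 2 * (P%:R / Q%:R)) ^+ n * (L + 2 * m)%:R ^+ n :> R.
Proof.
move=> P0 Q0 Kr ratio kdiam hm AL Ak.
pose B : {fset 'rV[int]_n} := box (- m%:Z) (L + 2 * m).
have shiftB z h : z \in A -> N (F h) <= r -> z + h \in B.
  move=> /AL + /hm hb; rewrite !in_box => /forallP zb; apply/forallP => i.
  have := hb i; have := zb i; rewrite ler_norml !mxE => /andP[z1 z2] /andP[h1 h2].
  apply/andP; split; first by rewrite -[leLHS]add0r lerD.
  rewrite add0r in z2.
  by rewrite (_ : _ + _%:Z = L%:Z + m%:Z); [exact: ltr_leD | lia].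
have F0 : F 0 = 0 by exact: raddf0.
have AB z : z \in A -> z \in B.
  move=> Az; rewrite -[z]addr0; apply: shiftB => //.
  by rewrite F0 (is_norm0 _ _ _ hN) (le_trans (mesh_ge0 F)).
pose C := [fset kappa z | z in B]%fset.
rewrite -natrX -(card_box (- m%:Z)) -/B.
rewrite (card_fibers_onto _ _ kappa A C); last by move=> z /AB Bz; apply: in_imfset.
rewrite (card_fibers _ _ kappa B) -/C !natr_sum mulr_sumr; apply: ler_sum => k _.
apply: (eroded_cell_card P Q r D) => //.
  move=> z z'; rewrite !inE => /andP[/= _ /eqP zk] /andP[/= _ /eqP zk'].
  by apply: kdiam; rewrite zk zk'.
move=> z h; rewrite !inE => /andP[/= Az /eqP zk] hr.
by rewrite shiftB//= Ak// zk eqxx.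
Qed.

End lower.

Lemma sum_probability_le d (T : measurableType d) (R : realType) (P : probability T R)
    (I : choiceType) (B : {fset I}) (E : I -> set T) (M : R) :
  (forall i, measurable (E i)) ->
  (forall w, #|` [fset i in B | w \in E i]%fset|%:R <= M) ->
  (\sum_(i <- B) P (E i) <= M%:E)%E.
Proof.
move=> mE EM.
(* The sum of the probabilities is the expected number of events that occur. *)
have -> : (\sum_(i <- B) P (E i) = \int[P]_w \sum_(i <- B) (\1_(E i) w)%:E)%E.
  rewrite ge0_integral_sum//; last first.
    by move=> i; apply/measurable_EFinP; exact: measurable_indic.
  by apply: eq_bigr => i _; rewrite integral_indic// setIT.
have -> : M%:E = (\int[P]_w (cst M%:E w))%E.
  by rewrite integral_cst// [X in (_ * X)%E](probability_setT P) mule1.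
apply: ge0_le_integral => //.
- by move=> w _; apply: sume_ge0 => i _; rewrite lee_fin.
- apply: emeasurable_sum => i; apply/measurable_EFinP; exact: measurable_indic.
move=> w _; rewrite sumEFin lee_fin; apply: le_trans (EM w).
rewrite card_fset_sum1 big_fset /= natr_sum [leRHS]big_mkcond /=.
by apply: ler_sum => i _; rewrite indicE; case: (w \in E i).
Qed.

(** * Random partitions and the lower bound *)

Lemma mclosed_ball_closed (R : realType) (M : metricType R) (x : M) (r : R) :
  closed (mclosed_ball x r).
Proof.
rewrite -openC openE => y /= /negP; rewrite -ltNge => ry.
apply/nbhs_ballP; exists (mdist x y - r); first by rewrite /= subr_gt0.
move=> z; rewrite ballEmdist /= => yz; apply/negP; rewrite -ltNge.
have := metric_triangle x z y; rewrite (metric_sym z y) => tri.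
by rewrite -(ltrD2r (mdist y z)); apply: lt_le_trans tri; rewrite -ltrBrDl.
Qed.

Section clusters.
Context (R : realType) (M : metricType R) (P : random_partition M).
Implicit Types (w : rp_space P) (x y : M).

Definition cluster_index w x : nat := pblock_index setT ((rp_cluster P)^~ w) x.

Lemma mem_cluster_index w x : rp_cluster P (cluster_index w x) w x.
Proof.
have [k _ kx] : cover setT ((rp_cluster P)^~ w) x by rewrite rp_cover.
by have [] := @getPex _ (fun i => setT i /\ rp_cluster P i w x) (ex_intro _ k (conj I kx)).
Qed.

Lemma cluster_indexP w x k : rp_cluster P k w x <-> cluster_index w x = k.
Proof.
split=> [kx|<-]; last exact: mem_cluster_index.
by apply: (@rp_disjoint _ _ P w) => //; exists x; split=> //; exact: mem_cluster_index.
Qed.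

Lemma cluster_ofP w x y : cluster_of P w x y <-> cluster_index w y = cluster_index w x.
Proof. exact: cluster_indexP. Qed.

(** A closed ball lies in a single cluster when it misses all clusters but one,
and strong measurability makes each of these countably many conditions
measurable. *)
Lemma measurable_padding_event x r : 0 <= r ->
  measurable [set w | mclosed_ball x r `<=` cluster_of P w x].
Proof.
move=> r0; pose hit j := [set w | mclosed_ball x r `&` rp_cluster P j w !=set0].
rewrite (_ : [set w | _] = \bigcup_k \bigcap_(j in [set j | j != k]) ~` hit j).
  apply: bigcup_measurable => k _; apply: bigcap_measurableType => j _.
  by apply: measurableC; apply: rp_strongly_measurable; exact: mclosed_ball_closed.
have xr : mclosed_ball x r x by rewrite /mclosed_ball /= mdistxx.
apply/seteqP; split=> [w /= sub|w [k _ /= one]].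
  exists (cluster_index w x) => // j /= /eqP jx [y [/sub/cluster_ofP yx /cluster_indexP yj]].
  by apply: jx; rewrite -yj yx.
have only y : mclosed_ball x r y -> cluster_index w y = k.
  move=> yr; apply/eqP/negPn/negP => yk; apply: (one _ yk).
  by exists y; split=> //; exact: mem_cluster_index.
by move=> y yr; apply/cluster_ofP; rewrite !only.
Qed.

Lemma bounded_partition_mdist D w x y : bounded_partition D P ->
  cluster_index w x = cluster_index w y -> mdist x y <= D.
Proof.
move=> /(_ w (cluster_index w x)) PD xy; rewrite -lee_fin; apply: le_trans PD.
apply: ereal_sup_ubound; exists (x, y) => //; split; first exact: mem_cluster_index.
by rewrite /= xy; exact: mem_cluster_index.
Qed.

End clusters.

Lemma nat_ratio_between (R : realType) (x y : R) : 0 <= x -> x < y ->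
  exists P Q : nat, [/\ (0 < P)%N, (0 < Q)%N & x < P%:R / Q%:R < y].
Proof.
move=> x0 xy; pose Q := (Num.trunc (y - x)^-1).+1; pose P := (Num.trunc (x * Q%:R)).+1.
have Q0 : (0 : R) < Q%:R by rewrite ltr0n.
exists P, Q; split=> //; rewrite ltr_pdivlMr// ltr_pdivrMr// truncnS_gt /=.
rewrite /P -natr1; apply: (@le_lt_trans _ _ (x * Q%:R + 1)).
  by rewrite lerD2r truncn_le mulr_ge0// ltW.
have := truncnS_gt (y - x)^-1; rewrite -/Q -[X in X < _]div1r ltr_pdivrMr ?subr_gt0//.
by rewrite mulrBr; lra.
Qed.

Lemma le_of_mul_le_nat (R : realType) (t c : R) (m : nat) :
  (forall L : nat, t * L%:R <= c * (L + m)%:R) -> t <= c.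
Proof.
move=> le_tc; rewrite leNgt; apply/negP => ct.
have ct0 : 0 < t - c by rewrite subr_gt0.
pose L := (Num.trunc (c * m%:R / (t - c))).+1.
have := truncnS_gt (c * m%:R / (t - c)); rewrite -/L ltr_pdivrMr// => cL.
have := le_tc L; rewrite natrD; move: cL; rewrite mulrBr mulrDr !(mulrC L%:R); lra.
Qed.

Section lower_bound.
Context (R : realType) (V : lmodType R) (N : V -> R) (hN : is_norm N) (n : nat).
Context (F : lattice_frame R V N n).
Context (n0 : (0 < n)%N).

(** Compare the expected number of padded lattice points in the box of side [L]
with its sure upper bound, and let [L] grow. *)
Lemma padded_fraction (P Q : nat) (p t D : R) (X : random_partition (normed_space hN)) :
  (0 < P)%N -> (0 < Q)%N -> 0 < t -> mesh F <= D / p ->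
  P%:R / Q%:R * (D + mesh F + 2 * mesh F) + mesh F <= D / p - mesh F ->
  bounded_partition D X -> padded_partition D p (t ^+ n) X ->
  t <= 1 - 2 * (P%:R / Q%:R).
Proof.
move=> P0 Q0 t0 Kr ratio Xb Xp; set c := 1 - _; set r := D / p.
have r0 : 0 <= r := le_trans (mesh_ge0 F) Kr.
have [m hm] := lattice_coord_nat R V N n F r.
suff : t <= Num.max 0 c by rewrite le_max leNgt t0.
apply: (@le_of_mul_le_nat _ _ _ (2 * m)) => L.
have c0 : 0 <= Num.max 0 c by rewrite le_max lexx.
rewrite -(@ler_pXn2r _ n n0) ?nnegrE ?mulr_ge0 ?(ltW t0)// !exprMn.
pose E z := [set w | mclosed_ball (F z : normed_space hN) r
                       `<=` cluster_of X w (F z : normed_space hN)].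
have le_sum : (\sum_(z <- box 0%R L) rp_prob X (E z)
    <= (Num.max 0 c ^+ n * (L + 2 * m)%:R ^+ n)%:E)%E.
  apply: sum_probability_le => [z|w]; first exact: measurable_padding_event.
  pose kappa z := cluster_index R _ X w (F z : normed_space hN).
  apply: (monochromatic_fraction R V N hN n F n0 P Q r D _ kappa) => //.
  - move=> z z' zz'; rewrite -(@mdist_normed_space _ _ _ hN); exact: bounded_partition_mdist Xb zz'.
  - by move=> z; rewrite inE => /andP[].
  move=> z h; rewrite inE => /andP[/= _ /set_mem zE] hr.
  apply/cluster_ofP; apply: zE; rewrite /mclosed_ball /= mdist_normed_space.
  by rewrite (raddfD F) opprD addNKr is_normN.
rewrite -lee_fin; apply: le_trans le_sum.
rewrite -natrX -(@card_box n 0 L) card_fset_sum1 natr_sum mulr_sumr -sumEFin.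
by apply: lee_sum => z _; rewrite mulr1; exact: Xp.
Qed.

(** Otherwise a rational [P / Q] fits strictly between [(1 - t) / 2] and [1 / p],
which contradicts [padded_fraction] for a partition of large diameter. *)
Lemma padding_parameter_ge (p t : R) : 0 < t -> t < 1 -> 0 < p ->
  (forall D : R, 0 < D -> exists X : random_partition (normed_space hN),
     bounded_partition D X /\ padded_partition D p (t ^+ n) X) ->
  2 / (1 - t) <= p.
Proof.
move=> t0 t1 p0 Hp; have t10 : 0 < 1 - t by rewrite subr_gt0.
rewrite ler_pdivrMr// leNgt; apply/negP => lt_p.
have lt_pV : (1 - t) / 2 < p^-1.
  by rewrite -[p^-1]mul1r ltr_pdivlMr//; move: lt_p; rewrite (mulrC p); lra.
have [|P [Q [P0 Q0 /andP[lo hi]]]] := nat_ratio_between R _ _ _ lt_pV.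
  by rewrite divr_ge0// ltW.
set K := mesh F; have K0 : 0 <= K := mesh_ge0 F.
set c := P%:R / Q%:R in lo hi.
have c0 : 0 <= c by rewrite divr_ge0.
have e0 : 0 < p^-1 - c by rewrite subr_gt0.
(* The diameter is taken so large that the mesh becomes negligible. *)
pose B := (2 * K + 3 * c * K) / (p^-1 - c).
have B0 : 0 <= B by rewrite divr_ge0 ?(ltW e0)// addr_ge0// !mulr_ge0.
have BE : B * (p^-1 - c) = 2 * K + 3 * c * K by rewrite divfK// gt_eqF.
pose D := p * (1 + K) + B.
have D0 : 0 < D by rewrite ltr_wpDr// mulr_gt0// ltr_wpDr.
have DpE : D / p = 1 + K + B / p by rewrite /D mulrDl mulrAC divff ?gt_eqF// mul1r.
have [X [Xb Xp]] := Hp D D0.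
suff : t <= 1 - 2 * c by move: lo; lra.
apply: (padded_fraction P Q p t D X) => //.
  by rewrite DpE -/K; have : 0 <= B / p by [rewrite divr_ge0// ltW]; lra.
rewrite -/c -/K.
have : 0 <= (1 + K) * p * (p^-1 - c) by rewrite !mulr_ge0 ?(ltW p0) ?(ltW e0)// addr_ge0.
have -> : D / p = D * (p^-1 - c) + D * c by ring.
rewrite [D * (p^-1 - c)]mulrDl BE (mulrC p); lra.
Qed.
End lower_bound.

(** * Uniform random orders of a finite set *)

Section uniform_probability.
Context (R : realType) (m : nat).

Definition uniform_nat : set nat -> \bar R :=
  mscale ((m.+1%:R)^-1 : R)%:nng (msum (fun i : nat => \d_i) m.+1).

HB.instance Definition _ := Measure.on uniform_nat.

Lemma uniform_natE (A : set nat) :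
  uniform_nat A = ((\sum_(i < m.+1) (val i \in A))%:R / m.+1%:R)%:E.
Proof.
have -> : uniform_nat A = ((m.+1%:R)^-1%:E * \sum_(i < m.+1) \d_(val i) A)%E by [].
under eq_bigr do rewrite diracE.
by rewrite sumEFin -EFinM -natr_sum mulrC.
Qed.

Lemma uniform_nat_setT : uniform_nat setT = 1%E.
Proof.
rewrite uniform_natE (eq_bigr (fun=> 1%N)) => [|i _]; last by rewrite in_setT.
by rewrite sum1_card card_ord divff// pnatr_eq0.
Qed.

HB.instance Definition _ := Measure_isProbability.Build _ _ _ uniform_nat uniform_nat_setT.

End uniform_probability.

(** The natural numbers carry the discrete sigma-algebra, so a uniform random
element of a finite type is realized on them by an enumeration. *)
Lemma uniform_finite (R : realType) (T : finType) (t0 : T) :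
  exists (Pr : probability nat R) (f : nat -> T), forall B : {pred T},
    Pr [set i | f i \in B] = (#|B|%:R / #|T|%:R)%:E.
Proof.
case cT : #|T| => [|m]; first by have := max_card (pred1 t0); rewrite card1 cT.
exists (uniform_nat R m), (fun i => nth t0 (enum T) i) => B.
apply: etrans (uniform_natE _ _ _) _; congr ((_%:R / _)%:E).
rewrite -sum1_card [RHS]big_mkcond -[RHS]big_enum (big_nth t0) -cardE cT big_mkord.
apply: eq_bigr => i _; case: ifPn => [Bi|/negP Bi]; first by rewrite mem_set.
by rewrite memNset.
Qed.

Section random_order.
Context {T : finType}.
Implicit Types (s : {perm T}) (S : {pred T}) (t : T).

Definition is_first s S t :=
  (t \in S) && [forall u in S, (enum_rank (s t) <= enum_rank (s u))%N].

Lemma exists_first s S : (0 < #|S|)%N -> exists t, is_first s S t.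
Proof.
case/card_gt0P => t0 St0; case: (arg_minnP (fun t => enum_rank (s t) : nat) St0) => t St tmin.
exists t; apply/andP; split=> //; apply/forall_inP => u; exact: tmin.
Qed.

Lemma is_first_inj s S t u : is_first s S t -> is_first s S u -> t = u.
Proof.
move=> /andP[St /forall_inP tmin] /andP[Su /forall_inP umin].
apply: (@perm_inj _ s); apply: enum_rank_inj; apply: val_inj; apply/eqP.
by rewrite eqn_leq tmin// umin.
Qed.

(** Precomposing with the transposition of [t] and [u] exchanges the orders in
which [t] comes first with those in which [u] does. *)
Lemma card_is_first_eq S t u : t \in S -> u \in S ->
  #|[pred s | is_first s S t]| = #|[pred s | is_first s S u]|.
Proof.
have le v w : v \in S -> w \in S ->
    (#|[pred s | is_first s S v]| <= #|[pred s | is_first s S w]|)%N.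
  move=> Sv Sw; rewrite -(fintype.card_image (@mulgI _ (tperm v w)) [pred s | is_first s S v]).
  apply: subset_leq_card; apply/fintype.subsetP => _ /fintype.imageP[s + ->].
  rewrite !inE => /andP[_ /forall_inP vmin]; apply/andP; split=> //.
  apply/forall_inP => x Sx; rewrite !permM tpermR; apply: vmin.
  by case: tpermP => // ->.
by move=> St Su; apply/eqP; rewrite eqn_leq !le.
Qed.

(** The first element of [S] in a uniform random order is uniform in [S]. *)
Lemma card_first_in S S' : {subset S' <= S} -> (0 < #|S|)%N ->
  (#|[pred s | [exists t in S', is_first s S t]]| * #|S| = #|S'| * #|{perm T}|)%N.
Proof.
move=> S'S S0; have [t0 St0] := card_gt0P S0.
pose c := #|[pred s | is_first s S t0]|.
have countE (U : {pred T}) : {subset U <= S} ->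
    #|[pred s | [exists t in U, is_first s S t]]| = (#|U| * c)%N.
  move=> US; rewrite -sum_nat_const.
  rewrite (eq_bigr (fun t => \sum_(s | is_first s S t) 1)%N) => [|t Ut]; last first.
    by rewrite /c (card_is_first_eq S t0 t)// ?US// sum1_card.
  rewrite (exchange_big_dep (fun s => [exists t in U, is_first s S t])) /=.
    rewrite -sum1_card; apply: eq_bigr => s /exists_inP[t Ut ft].
    rewrite (big_pred1 t)// => u /=; apply/andP/eqP => [[_ fu]|->//].
    exact: is_first_inj fu ft.
  by move=> t s Ut ft; apply/exists_inP; exists t.
have -> : #|{perm T}| = (#|S| * c)%N.
  rewrite -countE//; apply: eq_card => s; rewrite !inE.
  have [t ft] := exists_first s S S0; apply/esym/exists_inP; exists t => //.
  by case/andP: ft.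
by rewrite countE// mulnAC mulnA.
Qed.

End random_order.

(** * The random partition of the upper bound *)

Section discrete_partition.
Context (R : realType) (M : metricType R) (Pr : probability nat R)
  (T : countType) (f : nat -> M -> T).

Let fiber (k : nat) (w : nat) : set M := [set x | choice.pickle (f w x) = k].

Let fiber_cover w : cover setT (fiber^~ w) = setT.
Proof. by apply/seteqP; split=> // x _; exists (choice.pickle (f w x)). Qed.

Let fiber_disjoint w : trivIset setT (fiber^~ w).
Proof. by move=> i j _ _ [x [/= <- <-]]. Qed.

Let fiber_measurable k (E : set M) : closed E ->
  measurable [set w | E `&` fiber k w !=set0].
Proof. by []. Qed.

(** Every subset of the natural numbers is measurable, so the fibers of any random
map to a countable type form a random partition. *)
Definition fiber_partition : random_partition M :=
  @RandomPartition R M _ nat Pr fiber fiber_cover fiber_disjoint fiber_measurable.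

Lemma fiber_partition_bounded (D : R) :
  (forall w x y, f w x = f w y -> mdist x y <= D) ->
  bounded_partition D fiber_partition.
Proof.
move=> fD w k; apply: ge_ereal_sup => _ [[x y] [/= xk yk] <-]; rewrite lee_fin.
by apply: (fD w); apply: (pcan_inj choice.pickleK); rewrite xk yk.
Qed.

Lemma fiber_partition_cluster w x y : f w y = f w x -> cluster_of fiber_partition w x y.
Proof.
move=> yx; apply/cluster_ofP; apply/cluster_indexP => /=.
have : rp_cluster fiber_partition (choice.pickle (f w x)) w x by [].
by move/cluster_indexP ->; rewrite /fiber /= yx.
Qed.

End discrete_partition.

Section upper.
Context (R : realType) (V : lmodType R) (N : V -> R) (hN : is_norm N) (n : nat).
Context (F : lattice_frame R V N n).

Local Notation K := (mesh F).
Local Notation lball := (lattice_ball R V N n F).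
Let in_lball := in_lattice_ball R V N hN n F.

(** Reduce the coordinates modulo an integer larger than those of any lattice
vector of norm at most [rho]. *)
Lemma separating_coloring (rho : R) :
  exists (T : finType) (col : 'rV[int]_n -> T),
    forall z z', N (F z - F z') <= rho -> col z = col z' -> z = z'.
Proof.
have [m hm] := lattice_coord_nat R V N n F rho.
exists 'rV['I_m.+1]_n, (fun z => \row_i inord `|(z 0%R i %% m.+1%:Z)%Z|%N).
move=> z z' zz' /rowP col; apply/rowP => i; apply/eqP; rewrite -subr_eq0.
have := hm (z - z'); rewrite (raddfB F) => /(_ zz' i); rewrite !mxE => small.
have := col i; rewrite !mxE => /(congr1 val); rewrite /= !inordK => [cong||].
have cong' : (z 0%R i %% m.+1%:Z)%Z = (z' 0%R i %% m.+1%:Z)%Z.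
  by have := @modz_ge0 (z 0 i) m.+1; have := @modz_ge0 (z' 0 i) m.+1; lia.
have dv : (m.+1%:Z %| z 0%R i - z' 0%R i)%Z by rewrite -eqz_mod_dvd; apply/eqP.
case/dvdzP: dv small => e ->. 
rewrite normrM => small; rewrite mulf_eq0; apply/orP; left.
rewrite -normr_eq0 eq_le normr_ge0 andbT leNgt; apply/negP => e0. nia.
all: by have := @modz_ge0 (z 0 i) m.+1; have := @modz_ge0 (z' 0 i) m.+1; have := @ltz_pmod (z 0 i) m.+1; have := @ltz_pmod (z' 0 i) m.+1; lia.
Qed.

(** The ball around [x] is padded as soon as the first coloured lattice point of
the larger ball around [s *: x] lies in the smaller one; the ratio of the two
counts is at least [c ^ n] for a rational [c] strictly above [t]. *)
Lemma padding_parameter_exists (p t : R) : 0 < t -> t < 1 ->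
  2 * (1 + t) / (1 - t) < p ->
  forall D : R, 0 < D -> exists X : random_partition (normed_space hN),
     bounded_partition D X /\ padded_partition D p (t ^+ n) X.
Proof.
move=> t0 t1 lt_p D D0; have K0 : 0 <= K := mesh_ge0 F.
have p0 : 0 < p by apply: le_lt_trans lt_p; rewrite divr_ge0 ?mulr_ge0; lra.
have {}lt_p : 2 * (1 + t) < p * (1 - t) by rewrite -ltr_pdivrMr ?subr_gt0.
pose rad := D / 2; pose r := D / p.
have rad0 : 0 < rad by rewrite divr_gt0.
have r0 : 0 < r by rewrite divr_gt0.
have rrad0 : 0 < rad + r by rewrite addr_gt0.
have tR : t < (rad - r) / (rad + r).
  have DE : D = p * r by rewrite /r mulrC divfK// gt_eqF.
  rewrite ltr_pdivlMr// /rad DE.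
  rewrite -subr_gt0 (_ : _ - _ = r / 2 * (p * (1 - t) - 2 * (1 + t))); last by field.
  by rewrite mulr_gt0 ?divr_gt0// subr_gt0.
have [P [Q [P0 Q0 /andP[tc cR]]]] := nat_ratio_between R _ _ (ltW t0) tR.
have Q0' : (0 : R) < Q%:R by rewrite ltr0n.
set c := P%:R / Q%:R in tc cR.
have c0 : 0 <= c by rewrite divr_ge0.
(* The lattice is scaled down by [s], chosen so large that the mesh is smaller than
   [rad] and than the room left by [c] between the two radii. *)
pose e := (rad - r) - c * (rad + r).
have e0 : 0 < e by rewrite subr_gt0 -ltr_pdivlMr.
pose B := (2 * c * K + K) / e.
have B0 : 0 <= B by rewrite divr_ge0 ?(ltW e0)// addr_ge0// !mulr_ge0.
pose B' := K / rad.
have B'0 : 0 <= B' by rewrite divr_ge0// ltW.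
pose s := B + B' + 1.
have s0 : 0 < s by rewrite ltr_wpDl// addr_ge0.
have sK : K <= s * rad.
  have : K = B' * rad by rewrite divfK// gt_eqF.
  by have := mulr_ge0 B0 (ltW rad0); rewrite /s; lra.
have sratio : c * (s * (rad + r) + 2 * K) + K <= s * (rad - r).
  have : 2 * c * K + K = B * e by rewrite divfK// gt_eqF.
  have : s * (rad - r) = s * e + s * (c * (rad + r)) by rewrite /e; ring.
  have := mulr_ge0 B'0 (ltW e0).
  have : s * e = B * e + B' * e + e by rewrite /s; ring.
  by have -> : c * (s * (rad + r) + 2 * K) = s * (c * (rad + r)) + 2 * c * K; [ring | lra].
have [T [col colP]] := separating_coloring (2 * (s * (rad + r))).
have [Pr [g PrE]] := uniform_finite R {perm T} (perm_one T).
pose rank w z : nat := enum_rank (g w (col z)).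
have nearest (wx : nat * V) : exists z, z \in lball (s *: wx.2) (s * rad) /\
    forall z', z' \in lball (s *: wx.2) (s * rad) -> (rank wx.1 z <= rank wx.1 z')%N.
  have [|z zb zmin] := fset_argmin _ nat _ (rank wx.1) (lball (s *: wx.2) (s * rad)).
    have [z xz] := lattice_cover F (s *: wx.2); apply/fset0Pn; exists z.
    by rewrite in_lball is_normB// (le_trans xz).
  by exists z.
have [f0 f0P] := choice nearest.
pose f w (x : normed_space hN) := f0 (w, x).
have fb w x : N (F (f w x) - s *: (x : V)) <= s * rad.
  by have [+ _] := f0P (w, x); rewrite in_lball.
have fmin w x z : N (F z - s *: (x : V)) <= s * rad -> (rank w (f w x) <= rank w z)%N.
  by have [_ h] := f0P (w, x); rewrite -in_lball; exact: h.
exists (fiber_partition R _ Pr _ f); split.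
  apply: fiber_partition_bounded => w x y xy; rewrite mdist_normed_space.
  rewrite -(ler_pM2l s0) -{1}(gtr0_norm s0) -(is_norm_scale hN) scalerBr.
  apply: le_trans (is_norm_dist _ _ _ hN _ (F (f w x)) _) _.
  rewrite is_normB// {2}xy; apply: le_trans (lerD (fb _ _) (fb _ _)) _.
  by rewrite -mulrDr -splitr.
pose big := s * (rad + r); pose small := s * (rad - r).
move=> x; pose sx : V := s *: (x : V).
have col_inj : {in lball sx (big) &, injective col}.
  move=> z z'; rewrite !in_lball => zr zr'; apply: colP.
  apply: le_trans (is_norm_dist _ _ _ hN _ sx _) _.
  by rewrite (is_normB _ _ _ hN sx) mulr_natl mulr2n lerD.
have ball_mono rho : rho <= big ->
    {subset lball sx rho <= lball sx (big)}.
  by move=> le_rho z; rewrite !in_lball => /le_trans; apply.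
pose colors rho : {pred T} := [pred c | c \in [fset col z | z in lball sx rho]%fset].
have cardS rho : rho <= big -> #|colors rho| = #|` lball sx rho|.
  move=> le_rho; transitivity #|mem (enum_fset [fset col z | z in lball sx rho]%fset)|.
    exact: eq_card.
  rewrite (card_uniqP (fset_uniq _)) card_in_imfset //=.
  by move=> z z' /(ball_mono _ le_rho) zb /(ball_mono _ le_rho); exact: col_inj.
have srr : small <= big by rewrite /small /big ler_pM2l//; move: r0; lra.
have srad : s * rad <= big by rewrite /big ler_pM2l//; move: r0; lra.
have fball w (y : normed_space hN) : N ((x : V) - (y : V)) <= r ->
    f w y \in lball sx (big).
  move=> xy; rewrite in_lball.
  apply: le_trans (is_norm_dist _ _ _ hN _ (s *: (y : V)) _) _.
  rewrite /big mulrDr lerD// -scalerBr (is_norm_scale hN) gtr0_norm// ler_pM2l//.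
  by rewrite is_normB.
have xx : N ((x : V) - (x : V)) <= r by rewrite subrr is_norm0// ltW.
have S_sub : {subset colors (small) <= colors (big)}.
  by move=> c' /imfsetP[z /= zb ->]; apply: in_imfset; exact: ball_mono zb.
have S_gt0 : (0 < #|colors big|)%N.
  by apply/card_gt0P; exists (col (f 0%N x)); apply: in_imfset; exact: fball.
pose good : {pred {perm T}} := [pred sigma |
  [exists u in colors small, is_first sigma (colors big) u]].
apply: (@le_trans _ _ (Pr [set w | g w \in good])).
  rewrite PrE lee_fin ler_pdivlMr; last by rewrite ltr0n; apply/card_gt0P; exists (perm_one T).
  have Sr : (0 : R) < #|colors big|%:R by rewrite ltr0n.
  rewrite -(ler_pM2r Sr) -[leRHS]natrM card_first_in// natrM mulrAC ler_wpM2r//.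
  rewrite !cardS//; apply: (@le_trans _ _ (c ^+ n * #|` lball sx (big)|%:R)).
    by rewrite ler_wpM2r// lerXn2r ?nnegrE// ltW.
  rewrite /c expr_div_n mulrAC ler_pdivrMr ?exprn_gt0// -!natrX -!natrM ler_nat.
  apply: leq_trans (lattice_ball_ratio R V N hN n F P Q sx sx _ P0 Q0) _.
  rewrite mulnC leq_mul2r; apply/orP; right; apply: fsubset_leq_card.
  by apply/fsubsetP => z; rewrite !in_lball => /le_trans; apply.
apply: le_measure; [by apply: mem_set|by apply: mem_set|].
move=> w /= /exists_inP[u /imfsetP[z0 /= z0b ->] /andP[_ /forall_inP z0first]].
(* Every lattice point eligible for [y] lies in the larger ball around [x], and
   [z0] is eligible, so the first of them is [z0]. *)
have fz0 (y : normed_space hN) : N ((x : V) - (y : V)) <= r -> f w y = z0.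
  move=> xy; apply: col_inj; [exact: fball|exact: ball_mono z0b|].
  apply: (@perm_inj _ (g w)); apply: enum_rank_inj; apply: val_inj; apply/eqP.
  rewrite eqn_leq z0first ?andbT; last by apply: in_imfset; exact: fball.
  apply: fmin; move: z0b; rewrite in_lball => z0b.
  apply: le_trans (is_norm_dist _ _ _ hN _ sx _) _.
  rewrite -[rad](subrK r) mulrDr lerD// -scalerBr (is_norm_scale hN) gtr0_norm//.
  by rewrite ler_pM2l.
move=> y /= xy; apply: (fiber_partition_cluster _ _ Pr); exact: etrans (fz0 y xy) (esym (fz0 x xx)).
Qed.
End upper.

(** * Lattices in finite-dimensional normed spaces *)

Section basis_lattice.
Context (R : realType) (V : vectType R).
Local Notation n := (\dim {:V}).
Local Notation b := (vbasis {:V}).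

Definition lin_comb (x : 'rV[R]_n) : V := \sum_(i < n) x 0 i *: b`_i.

Definition basis_point (z : 'rV[int]_n) : V := lin_comb (map_mx intr z).

Lemma lin_combB : {morph lin_comb : x y / x - y}.
Proof.
move=> x y; rewrite /lin_comb -sumrB; apply: eq_bigr => i _.
by rewrite !mxE scalerBl.
Qed.

Lemma lin_combZ (a : R) : {morph lin_comb : x / a *: x}.
Proof.
move=> x; rewrite /lin_comb scaler_sumr; apply: eq_bigr => i _.
by rewrite mxE scalerA.
Qed.

Lemma lin_comb_eq0 x : lin_comb x = 0 -> x = 0.
Proof.
move=> /(freeP (basis_free (vbasisP fullv)) (fun i => x 0 i)) x0.
by apply/rowP => i; rewrite mxE x0.
Qed.

Lemma basis_point_additive : zmod_morphism basis_point.
Proof. by move=> y z; rewrite /basis_point map_mxB lin_combB. Qed.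

HB.instance Definition _ := GRing.isZmodMorphism.Build _ _ basis_point basis_point_additive.

Context (N : V -> R) (hN : is_norm N).

Definition basis_norm : R := \sum_(i < n) N b`_i.

Lemma basis_norm_ge0 : 0 <= basis_norm.
Proof. by apply: sumr_ge0 => i _; exact: is_norm_ge0. Qed.

Lemma lin_comb_le (x : 'rV[R]_n) (m : R) : (forall i, `|x 0 i| <= m) -> N (lin_comb x) <= m * basis_norm.
Proof.
move=> xm; rewrite /basis_norm mulr_sumr /lin_comb.
elim/big_ind2 : _ => [|u s v t us vt|i _].
- by rewrite is_norm0.
- by apply: le_trans (is_norm_triangle hN _ _) _; exact: lerD.
- by rewrite (is_norm_scale hN) ler_wpM2r// is_norm_ge0.
Qed.

Lemma le_mx_norm (x : 'rV[R]_n) i : `|x 0 i| <= `|x|.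
Proof. by rewrite [leRHS]/Num.norm /= mx_normrE; apply: (le_bigmax _ _ (0, i)). Qed.

Lemma continuous_lin_comb : continuous (fun x => N (lin_comb x)).
Proof.
move=> x; apply/(@cvgrPdist_le _ _ _ _ (nbhs_filter x)) => /= e e0.
have B0 : 0 < basis_norm + 1 by rewrite ltr_wpDl// basis_norm_ge0.
near=> y.
have Nxy : N (lin_comb (x - y)) <= e.
  apply: le_trans (lin_comb_le _ _ (le_mx_norm _)) _.
  apply: (@le_trans _ _ (`|x - y| * (basis_norm + 1))).
    by rewrite ler_wpM2l// lerDl.
  rewrite -ler_pdivlMr//; near: y.
  by apply: cvgr_dist_le; [exact: cvg_id|rewrite divr_gt0].
apply: le_trans Nxy; rewrite lin_combB ler_norml lerBrDl lerBlDl.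
have := is_norm_dist _ _ _ hN (lin_comb x) (lin_comb y) 0.
have := is_norm_dist _ _ _ hN (lin_comb y) (lin_comb x) 0.
by rewrite !subr0 (is_normB _ _ _ hN (lin_comb y)); lra.
Unshelve. all: by end_near. Qed.

(** By homogeneity it is enough that the continuous function [N (lin_comb x)] has
a positive minimum on the compact unit sphere. *)
Lemma norm_equivalence : (0 < n)%N ->
  exists2 c : R, 0 < c & forall x, `|x| <= c * N (lin_comb x).
Proof.
move=> n0; pose S := [set x : 'rV[R]_n | `|x| = 1].
have S0 : S !=set0.
  pose e : 'rV[R]_n := const_mx 1.
  have e0 : e != 0.
    by apply/eqP => /rowP/(_ (Ordinal n0)); rewrite !mxE => /eqP; rewrite oner_eq0.
  exists (`|e|^-1 *: e); rewrite /S /= normrZ normfV normr_id mulVf//.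
  by rewrite normr_eq0.
have cS : compact S.
  apply: bounded_closed_compact.
    by exists 1; split=> // M M1 x /= ->; exact: ltW.
  rewrite (_ : S = (@Num.norm R _) @^-1` [set 1]) //.
  by apply: closed_comp; [move=> x _; exact: norm_continuous | exact: closed_eq].
have [x0 /set_mem Sx0 x0min] := compact_EVT_min S0 cS (continuous_subspaceT continuous_lin_comb).
have m0 : 0 < N (lin_comb x0).
  rewrite lt_neqAle is_norm_ge0// andbT eq_sym; apply/eqP => /(is_norm_eq0 hN)/lin_comb_eq0 x00.
  by move: Sx0; rewrite /S /= x00 normr0 => /esym/eqP; rewrite oner_eq0.
exists (N (lin_comb x0))^-1; first by rewrite invr_gt0.
move=> x; have [->|xn0] := eqVneq x 0.
  by rewrite normr0 mulr_ge0 ?invr_ge0 ?(ltW m0)// is_norm_ge0.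
rewrite ler_pdivlMl// mulrC -ler_pdivlMl ?normr_gt0//.
have := x0min (`|x|^-1 *: x); rewrite lin_combZ (is_norm_scale hN) normfV normr_id; apply.
by apply: mem_set; rewrite /S /= normrZ normfV normr_id mulVf// normr_eq0.
Qed.

Lemma basis_lattice_frame : (0 < n)%N -> inhabited (lattice_frame R V N n).
Proof.
move=> n0; have [c c0 cN] := norm_equivalence n0.
constructor; apply: (@LatticeFrame R V N n basis_point basis_norm _ _ _ c) => //.
- exact: basis_norm_ge0.
- move=> x; pose xi := \row_i coord b i x : 'rV[R]_n.
  have xE : x = lin_comb xi.
    rewrite [LHS](coord_vbasis (memvf x)); apply: eq_bigr => i _; by rewrite mxE.
  exists (map_mx (@Num.floor R) xi); rewrite {1}xE /= /basis_point -lin_combB -[leRHS]mul1r.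
  apply: lin_comb_le => i; rewrite !mxE.
  have /andP[lo hi] := floor_itv (coord b i x).
  by rewrite ger0_norm ?subr_ge0// lerBlDl ltW// -intrD1.
- move=> m z zm; apply: lin_comb_le => i; rewrite mxE.
  have /andP[z0 z1] := zm i.
  by rewrite ger0_norm ?ler0z// pmulrn ler_int.
- exact: ltW.
- move=> z i; apply: le_trans (cN _); apply: le_trans (le_mx_norm _ i).
  by rewrite mxE intr_norm.
Qed.
End basis_lattice.

(** * Bounds on the padding parameter *)

Section PAD_bounds.
Context (R : realType) (V : vectType R) (N : V -> R) (hN : is_norm N).
Local Notation n := (\dim {:V}).
Context (n0 : (0 < n)%N).

Lemma PAD_bounds (delta t : R) : 0 < t -> t < 1 -> t ^+ n = delta ->
  ((2 / (1 - t))%:E <= PAD (normed_space hN) delta)%E /\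
  (PAD (normed_space hN) delta <= (2 * (1 + t) / (1 - t))%:E)%E.
Proof.
move=> t0 t1 <-; have [F] := basis_lattice_frame R V N hN n0; split.
  apply: le_ereal_inf_tmp => _ [p [p0 Hp] <-]; rewrite lee_fin.
  exact: (padding_parameter_ge R V N hN n F n0).
apply/lee_addgt0Pr => e e0; rewrite -EFinD; apply: ereal_inf_lbound.
exists (2 * (1 + t) / (1 - t) + e) => //; split.
  by rewrite ltr_wpDl// divr_ge0 ?mulr_ge0//; lra.
apply: (padding_parameter_exists R V N hN n F) => //.
by rewrite ltrDl.
Qed.

End PAD_bounds.

Lemma nth_root_itv (R : realType) (n : nat) (delta : R) : (0 < n)%N ->
  0 < delta -> delta < 1 ->
  [/\ 0 < delta `^ n%:R^-1, delta `^ n%:R^-1 < 1 & (delta `^ n%:R^-1) ^+ n = delta].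
Proof.
move=> n0 d0 d1.
have tn : (delta `^ n%:R^-1) ^+ n = delta.
  by rewrite -powR_mulrn ?powR_ge0// -powRrM mulVf ?powRr1 ?ltW// pnatr_eq0 -lt0n.
split; rewrite ?powR_gt0//.
by rewrite -(@ltr_pXn2r _ n n0) ?nnegrE ?powR_ge0// expr1n tn.
Qed.

(** With [u = ln (1 / delta) / n] one has [t = exp (- u)], and
[u / (1 + u) <= 1 - exp (- u) <= min 1 u]. *)
Lemma inv_one_minus_root_bounds (R : realType) (n : nat) (delta : R) : (0 < n)%N ->
  0 < delta -> delta < 1 -> let t := delta `^ n%:R^-1 in
  let m := Num.max 1 (n%:R / ln (1 / delta)) in
  m <= 1 / (1 - t) /\ 1 / (1 - t) <= 2 * m.
Proof.
move=> n0 d0 d1 t m; have [t0 t1 _] := nth_root_itv R n delta n0 d0 d1.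
rewrite -/t in t0 t1.
have n0' : (0 : R) < n%:R by rewrite ltr0n.
have ld : 0 < - ln delta by rewrite oppr_gt0 ln_lt0// d0.
pose u := - ln delta / n%:R; have u0 : 0 < u by rewrite divr_gt0.
have tE : t = expR (- u).
  by rewrite /t /powR gt_eqF// /u; congr expR; rewrite mulNr opprK mulrC.
have mE : m = Num.max 1 (1 / u) by rewrite /m div1r lnV ?posrE// div1r invf_div.
have t10 : 0 < 1 - t by rewrite subr_gt0.
have lo : 1 - t <= u by have := expR_ge1Dx (- u); rewrite -tE; lra.
have hi : u <= (1 + u) * (1 - t).
  have : (1 + u) * t <= 1.
    have := expR_ge1Dx u; rewrite -(ler_pM2r t0) => /le_trans; apply.
    by rewrite tE -expRD subrr expR0.
  lra.
rewrite {}mE; split.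
  rewrite ge_max; apply/andP; split.
    by rewrite ler_pdivlMr// mul1r; lra.
  by rewrite !div1r lef_pV2.
rewrite ler_pdivrMr//.
have [u1|u1] := leP u 1.
  apply: (@le_trans _ _ (2 * (1 / u) * (1 - t))).
    rewrite (_ : 2 * _ * _ = 2 * (1 - t) / u); last by rewrite div1r mulrAC.
    rewrite ler_pdivlMr// mul1r; apply: le_trans hi _.
    by rewrite ler_wpM2r ?(ltW t10)//; lra.
  by rewrite ler_wpM2r ?(ltW t10)// ler_wpM2l// le_max lexx orbT.
apply: (@le_trans _ _ (2 * 1 * (1 - t))).
  rewrite mulr1 -(ler_pM2r u0) mul1r mulrAC; apply: le_trans hi _.
  by rewrite ler_wpM2r ?(ltW t10)//; lra.
by rewrite ler_wpM2r ?(ltW t10)// ler_wpM2l// le_max lexx.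
Qed.

Theorem theorem69 (R : realType) :
  (forall n : nat, (0 < n)%N ->
   forall (N : 'rV[R]_n -> R) (hN : is_norm N) (delta : R),
   0 < delta -> delta < 1 ->
     ((1 / (1 - delta `^ (n%:R^-1)))%:E
        <= (1 / 2)%:E * PAD (normed_space hN) delta)%E /\
     ((1 / 2)%:E * PAD (normed_space hN) delta
        <= ((1 + delta `^ (n%:R^-1)) / (1 - delta `^ (n%:R^-1)))%:E)%E) /\
  (exists c C : R, [/\ 0 < c, 0 < C &
   forall V : vectType R, (0 < \dim {:V})%N ->
   forall (N : V -> R) (hN : is_norm N) (delta : R),
   0 < delta -> delta < 1 ->
     ((c * Num.max 1 ((\dim {:V})%:R / ln (1 / delta)))%:E
        <= PAD (normed_space hN) delta)%E /\
     (PAD (normed_space hN) delta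
        <= (C * Num.max 1 ((\dim {:V})%:R / ln (1 / delta)))%:E)%E]).
Proof.
split=> [n n0 N hN delta d0 d1|].
  have [t0 t1 tn] := nth_root_itv R n delta n0 d0 d1; set t := delta `^ _ in t0 t1 tn *.
  have dimn : \dim {:'rV[R]_n} = n by rewrite dimvf dim_matrix mul1r.
  have := @PAD_bounds R 'rV[R]_n N hN; rewrite dimn => /(_ n0 delta t t0 t1 tn)[lo hi].
  have half0 : (0 <= (1 / 2 : R)%:E)%E by rewrite lee_fin divr_ge0.
  have t10 : 1 - t != 0 by rewrite subr_eq0 gt_eqF.
  split.
    apply: le_trans (lee_wpmul2l half0 lo).
    by rewrite -EFinM lee_fin [leRHS](_ : _ = 1 / (1 - t))//; field.
  apply: le_trans (lee_wpmul2l half0 hi) _.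
  by rewrite -EFinM lee_fin [leLHS](_ : _ = (1 + t) / (1 - t))//; field.
exists 2, 8; split=> // V n0 N hN delta d0 d1.
have [t0 t1 tn] := nth_root_itv R _ delta n0 d0 d1.
have [lo hi] := inv_one_minus_root_bounds R _ delta n0 d0 d1.
have [Plo Phi] := PAD_bounds R V N hN n0 delta _ t0 t1 tn.
move: lo hi Plo Phi; set t := delta `^ _ in t0 t1 *; set m := Num.max _ _ => lo hi Plo Phi.
split.
  by apply: le_trans Plo; rewrite lee_fin; move: lo; rewrite div1r; lra.
apply: (le_trans Phi); rewrite lee_fin.
apply: (@le_trans _ _ (4 * (1 / (1 - t)))).
  by rewrite div1r ler_wpM2r ?invr_ge0 ?subr_ge0 ?ltW//; lra.
by move: hi; lra.
Qed.
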